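(* Let $G$ be a connected graph with $m$ edges. If $p\geq 1$ is an integer, then $$A_p(G)\leq (m-1)^{1-\frac{1}{p}}\left(A_{\frac{1}{p}}(G)\right)^{\frac{1}{p}}.$$
   Context: Graphs are finite, simple and undirected; $d(v)$ is the degree of vertex $v$ in $G$. For a positive real number $p$, the general Albertson irregularity index of a connected graph $G$ is $A_p(G)=\left(\sum_{uv\in E(G)}|d(u)-d(v)|^p\right)^{1/p}$; in particular $A_{1/p}(G)=\left(\sum_{uv\in E(G)}|d(u)-d(v)|^{1/p}\right)^{p}$. *)

(* Defs.v *)
From HB Require Import structures.
From mathcomp Require Import all_boot all_order all_algebra.
From mathcomp Require Import reals exp.

Set Implicit Arguments.
Unset Strict Implicit.
Unset Printing Implicit Defensive.

Import Order.TTheory GRing.Theory Num.Theory.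
Local Open Scope ring_scope.

Record simple_graph := SimpleGraph {
  vertex :> finType;
  adj : rel vertex;
  adj_sym : symmetric adj;
  adj_irr : irreflexive adj
}.

Definition deg (G : simple_graph) (v : G) : nat := #|[set u | adj v u]|.

(* Each undirected edge is represented by exactly one ordered pair: the one
   increasing for the enumeration of the vertices. *)
Definition edges (G : simple_graph) : {set G * G} :=
  [set e | adj e.1 e.2 && (enum_rank e.1 < enum_rank e.2)%N].

Definition connected_graph (G : simple_graph) : Prop :=
  (0 < #|G|)%N /\ forall u v : G, connect (@adj G) u v.

(* Intended for 0 < p, where 0 `^ p = 0. *)
Definition albertson (R : realType) (p : R) (G : simple_graph) : R :=
  (\sum_(e in edges G) `|(deg e.1)%:R - (deg e.2)%:R| `^ p) `^ p^-1.

(* Main.v *)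
Require Import Defs.
From HB Require Import structures.
From mathcomp Require Import all_boot all_order all_algebra.
From mathcomp Require Import reals exp.

Import Order.TTheory GRing.Theory Num.Theory.
Local Open Scope ring_scope.

(** Every edge [uv] satisfies [1 <= d(u), d(v) <= m], so its imbalance
    [a = |d(u) - d(v)|] is at most [m - 1] and [a^p <= (m - 1)^(p - 1) a].
    Summing, [\sum a^p <= (m - 1)^(p - 1) \sum a], while
    [\sum a <= (\sum a^(1/p))^p] because the l^p norm is at most the l^1 norm. *)

(** Sending a neighbour [w] of [v] to the edge between them, oriented as [edges] requires, injects
    the neighbourhood into [edges G]. *)
Lemma deg_le_card_edges (G : simple_graph) (v : G) : (deg v <= #|edges G|)%N.
Proof.
pose f w := if (enum_rank v < enum_rank w)%N then (v, w) else (w, v).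
have f_inj : {in [set w | adj v w] &, injective f}.
  move=> x y; rewrite !inE /f => vx vy.
  (* In the mixed cases the pairs have [v] in opposite places, which forces [x = v = y]. *)
  by case: ifP => _; case: ifP => _ [] // *; congruence.
rewrite /deg -(card_in_imset f_inj); apply/subset_leq_card/subsetP.
move=> _ /imsetP[w + ->]; rewrite inE /f => vw.
have wv : w != v by apply: contraTneq vw => ->; rewrite adj_irr.
case: ltngtP => [lt_vw|lt_wv|eq_vw]; rewrite inE /=.
- by rewrite vw.
- by rewrite adj_sym vw.
- by case/eqP: wv; apply/enum_rank_inj/val_inj.
Qed.

Lemma deg_gt0 (G : simple_graph) (u v : G) : adj u v -> (0 < deg u)%N.
Proof. by move=> uv; apply/card_gt0P; exists v; rewrite inE. Qed.

Lemma edge_imbalance_le (R : realDomainType) (G : simple_graph) (e : G * G) :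
  e \in edges G ->
  `|(deg e.1)%:R - (deg e.2)%:R| <= #|edges G|%:R - 1 :> R.
Proof.
rewrite inE => /andP[e12 _].
have e21 : adj e.2 e.1 by rewrite adj_sym.
(* A one-sided bound for arbitrary [u] and [v]: applied in both orders, it bounds the absolute
   value. *)
have deg_sub_le (u v : G) : (0 < deg v)%N ->
    (deg u)%:R - (deg v)%:R <= #|edges G|%:R - 1 :> R.
  by move=> v_gt0; rewrite lerB ?ler1n ?ler_nat ?deg_le_card_edges.
rewrite ler_norml lerNl opprB.
by rewrite !deg_sub_le ?(deg_gt0 _ _ _ e12) ?(deg_gt0 _ _ _ e21).
Qed.

(** Termwise, [n] of the [n.+1] factors are bounded by [M]. Leaving [M] free allows both [m - 1] and
    the sum of the [x i] itself. *)
Lemma ler_sum_exprS (R : numDomainType) (I : finType) (A : {set I})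
    (x : I -> R) (M : R) (n : nat) :
  (forall i, i \in A -> 0 <= x i <= M) ->
  \sum_(i in A) x i ^+ n.+1 <= M ^+ n * \sum_(i in A) x i.
Proof.
move=> xM; rewrite mulr_sumr; apply: ler_sum => i /xM /andP[x0 xi_le].
by rewrite exprSr ler_wpM2r // lerXn2r // nnegrE (le_trans x0).
Qed.

(** Nonnegative terms are each at most their sum, so the sum can serve as [M] in [ler_sum_exprS]. *)
Lemma sum_exprS_le (R : numDomainType) (I : finType) (A : {set I})
    (x : I -> R) (n : nat) :
  (forall i, i \in A -> 0 <= x i) ->
  \sum_(i in A) x i ^+ n.+1 <= (\sum_(i in A) x i) ^+ n.+1.
Proof.
move=> x0; rewrite [leRHS]exprSr; apply: ler_sum_exprS => i iA.
by rewrite x0 // (bigD1 i) //= lerDl sumr_ge0 // => j /andP[/x0].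
Qed.

Theorem theorem3p4 (R : realType) (G : simple_graph) (m p : nat)
    (G_connected : connected_graph G) (G_edges : #|edges G| = m)
    (p_ge1 : (1 <= p)%N) :
  albertson (p%:R : R) G <=
    (m%:R - 1) `^ (1 - 1 / p%:R) * albertson (1 / p%:R : R) G `^ (1 / p%:R).
Proof.
case: p p_ge1 => // n _; rewrite !div1r.
have n0 : n.+1%:R != 0 :> R by rewrite pnatr_eq0.
(* For [m = 0] the base [m - 1] is negative. The left side is then [0] to a nonzero power, hence
   [0], and [powR] is never negative. *)
have [m0|m_gt0] := posnP m.
  rewrite {1}/albertson (cards0_eq (etrans G_edges m0)) big_set0.
  by rewrite powR0 ?invr_eq0 // mulr_ge0 ?powR_ge0.
rewrite /albertson invrK.
set a := fun e : G * G => `|(deg e.1)%:R - (deg e.2)%:R| : R.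
set S := \sum_(e in edges G) a e `^ n.+1%:R^-1.
have S_ge0 : 0 <= S by apply: sumr_ge0 => e _; apply: powR_ge0.
have M_ge0 : 0 <= m%:R - 1 :> R by rewrite subr_ge0 ler1n.
have root_exp e : (a e `^ n.+1%:R^-1) ^+ n.+1 = a e.
  by rewrite -powR_mulrn ?powR_ge0 // -powRrM mulVf // powRr1 /a.
have sum_a_le : \sum_(e in edges G) a e <= S ^+ n.+1.
  (* Each [a e] is the [n.+1]-th power of its root, so the norm comparison applies to the roots. *)
  rewrite -(eq_bigr _ (fun e _ => root_exp e)).
  by apply: sum_exprS_le => e _; apply: powR_ge0.
have sum_exp_le :
    \sum_(e in edges G) a e `^ n.+1%:R <= (m%:R - 1) ^+ n * S ^+ n.+1.
  rewrite (eq_bigr (fun e => a e ^+ n.+1)); last first.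
    by move=> e _; rewrite powR_mulrn /a.
  apply: le_trans (ler_wpM2l (exprn_ge0 _ M_ge0) sum_a_le).
  apply: ler_sum_exprS => e eE.
  by rewrite normr_ge0 -G_edges edge_imbalance_le.
(* With [p = n.+1], the exponent [1 - 1/p] is [n / p]. The right side becomes a single [p]-th root,
   and monotonicity of the root reduces the goal to [sum_exp_le]. *)
have -> : 1 - n.+1%:R^-1 = n%:R * n.+1%:R^-1 :> R.
  by rewrite -[n%:R](addrK 1) natr1 mulrBl divff // mul1r.
rewrite powRrM -powRM ?powR_ge0 // !powR_mulrn //.
rewrite ge0_ler_powR ?invr_ge0 ?nnegrE ?mulr_ge0 ?exprn_ge0 //.
by apply: sumr_ge0 => e _; apply: powR_ge0.
Qed.
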